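(* The value $B(n)$ can be computed by the following algorithm. Use binary search, with initial lower bound $1$ and initial upper bound $n$ for $m$ (since $B(n)\leq n$), to seek an $m$ such that $n=m+R(m)$, where $R(m)$ is computed by summing its logarithmically many nonzero terms $R(m,i)$. In at most $O(\log(n))$ steps, the search either finds an $m$ with $n=m+R(m)$ or shows that none exists; in the latter case, the final lower bound found for $m$ satisfies $n=m+R(m)+1$. In either case $B(n)=m$. The total running time of this algorithm is $O(\log^2(n))$.
   Context: The sequence $(B(n))_{n\geq1}$ is defined by the initial conditions $B(1)=1$, $B(2)=2$, $B(3)=3$, $B(4)=4$, $B(5)=5$ and thereafter by the nested recurrence $$B(n)=B(n-B(n-1))+B(n-B(n-2))+B(n-B(n-3)).$$ The auxiliary sequence $(a_i)_{i\geq1}$ is defined by $a_1=3$ and $a_i=3a_{i-1}-1$ for $i\geq2$; equivalently $a_i=\frac{5}{2}\cdot3^{i-1}+\frac{1}{2}$. For a positive integer $m$ and $i\geq1$, let $R(m,i)=\max\left(0,\left\lfloor\frac{m-a_i-1}{3^i}\right\rfloor\right)$ and $R(m)=\sum_{i=1}^\infty R(m,i)$, a sum in which only logarithmically many terms (those with $a_i-1\leq m$) can be nonzero. *)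

(* Defs.v *)
From mathcomp Require Import all_boot all_order all_algebra.
From mathcomp Require Import zify.
Import Order.TTheory GRing.Theory Num.Theory.

Set Implicit Arguments.
Unset Strict Implicit.
Unset Printing Implicit Defensive.

(* Subtraction is truncated and [B 0] is left arbitrary: a theorem about every
   [B] with [isB B] may not rely on the value of an out-of-range index. *)
Definition isB (B : nat -> nat) : Prop :=
  [/\ [/\ B 1 = 1, B 2 = 2, B 3 = 3, B 4 = 4 & B 5 = 5]
    & forall n, 5 < n ->
        B n = B (n - B (n - 1)) + B (n - B (n - 2)) + B (n - B (n - 3))].

Fixpoint Btable (k : nat) : seq nat :=
  if k is k'.+1 then
    let t := Btable k' in
    let b := nth 0 t in
    rcons t (if k <= 5 then k else
               b (k - b (k - 1)) + b (k - b (k - 2)) + b (k - b (k - 3)))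
  else [:: 1].

Lemma isB_exists : exists B, isB B.
Proof.
have szT k : size (Btable k) = k.+1.
  by elim: k => //= k IH; rewrite size_rcons IH.
pose B n := nth 0 (Btable n) n.
have nthT k j : j <= k -> nth 0 (Btable k) j = B j.
  elim: k => [|k IH]; first by rewrite leqn0 => /eqP ->.
  rewrite leq_eqVlt => /orP[/eqP -> //|]; rewrite ltnS => jk.
  by rewrite [Btable _]/= nth_rcons szT ltnS jk IH.
have BS k : B k.+1 = if k.+1 <= 5 then k.+1 else
    nth 0 (Btable k) (k.+1 - nth 0 (Btable k) (k.+1 - 1))
    + nth 0 (Btable k) (k.+1 - nth 0 (Btable k) (k.+1 - 2))
    + nth 0 (Btable k) (k.+1 - nth 0 (Btable k) (k.+1 - 3)).
  by rewrite {1}/B [Btable k.+1]/= nth_rcons szT ltnn eqxx.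
have Bgt0 n : 0 < B n.
  elim/ltn_ind: n => -[//|k] IH; rewrite BS; case: ifP => // k5.
  have h1 : 0 < B (k.+1 - 1) by apply: IH; lia.
  have h2 : 0 < B (k.+1 - B (k.+1 - 1)) by apply: IH; lia.
  rewrite (nthT k (k.+1 - 1)); last lia.
  rewrite (nthT k (k.+1 - B _)); last lia.
  by rewrite -!addnA addn_gt0 h2.
exists B; split=> // -[//|k] k5.
rewrite BS ifF; last lia.
have h j : 0 < j <= 3 ->
    nth 0 (Btable k) (k.+1 - nth 0 (Btable k) (k.+1 - j)) = B (k.+1 - B (k.+1 - j)).
  move=> j3; rewrite (nthT k (k.+1 - j)); last lia.
  by rewrite nthT //; have := Bgt0 (k.+1 - j); lia.
by rewrite (h 1) ?(h 2) ?(h 3).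
Qed.

Definition a (i : nat) : nat := iter i.-1 (fun x => 3 * x - 1) 3.

Lemma a_closed i : 0 < i -> 2 * a i = 5 * 3 ^ i.-1 + 1.
Proof.
case: i => // i _; rewrite /a /=.
elim: i => [//|i IH]; rewrite iterS expnS.
have p3 : 0 < 3 ^ i by rewrite expn_gt0.
by move: IH p3; set x := iter _ _ _; set y := 3 ^ i; lia.
Qed.

Definition Rterm (m i : nat) : nat := (m - (a i + 1)) %/ 3 ^ i.

(* Truncated subtraction takes the place of the maximum with 0; [%/] on [int]
   by a positive divisor is the floor of the quotient. *)
Lemma RtermE m i :
  (Rterm m i)%:Z%R =
  Num.max 0%R ((m%:Z - (a i)%:Z - 1) %/ (3 ^ i)%N%:Z)%Z%R.
Proof.
have p3 : 0 < 3 ^ i by rewrite expn_gt0.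
rewrite /Rterm -divz_nat.
case: (leqP (a i + 1) m) => h.
  rewrite (_ : (m%:Z - (a i)%:Z - 1)%R = (m - (a i + 1))%N%:Z%R); last lia.
  by rewrite max_r // divz_nat.
rewrite (_ : m - (a i + 1) = 0)%N; last lia.
rewrite div0z max_l //; apply: ltW.
by rewrite ltz_divLR ?mul0r; lia.
Qed.

(* The infinite sum over i >= 1, cut where its terms are already 0; see
   [R_stable]. *)
Definition R (m : nat) : nat := \sum_(1 <= i < m.+1) Rterm m i.

Lemma R_stable m N : m <= N -> \sum_(1 <= i < N.+1) Rterm m i = R m.
Proof.
move=> mN; rewrite (@big_cat_nat _ _ _ m.+1) //= -/(R m).
rewrite [X in _ + X]big1_seq ?addn0 // => i /=.
rewrite mem_index_iota => /andP[mi _]; rewrite /Rterm.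
have ai : i < a i.
  rewrite /a; case: i mi => // i _ /=.
  elim: i => // i; rewrite iterS; set x := iter _ _ _; lia.
by rewrite (_ : m - _ = 0) ?div0n //; lia.
Qed.

Inductive var := vn | vlo | vhi | vm | va | vp | vr | vfound | vsteps.
Scheme Equality for var.

Inductive expr :=
| Var of var
| Cst of nat
| Add of expr & expr
| Sub of expr & expr
| Mul of expr & expr
| Div of expr & expr.

Inductive test :=
| Eq of expr & expr
| Le of expr & expr
| Lt of expr & expr
| And of test & test.

Inductive com :=
| Skip
| Assign of var & expr
| Seq of com & com
| If of test & com & com
| While of test & com.

Definition state := var -> nat.

Definition upd (s : state) (x : var) (v : nat) : state :=
  fun y => if var_beq y x then v else s y.

Fixpoint eval (s : state) (e : expr) : nat :=
  match e with
  | Var x => s x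
  | Cst c => c
  | Add e1 e2 => eval s e1 + eval s e2
  | Sub e1 e2 => eval s e1 - eval s e2
  | Mul e1 e2 => eval s e1 * eval s e2
  | Div e1 e2 => eval s e1 %/ eval s e2
  end.

Fixpoint holds (s : state) (b : test) : bool :=
  match b with
  | Eq e1 e2 => eval s e1 == eval s e2
  | Le e1 e2 => eval s e1 <= eval s e2
  | Lt e1 e2 => eval s e1 < eval s e2
  | And b1 b2 => holds s b1 && holds s b2
  end.

(* Every read, constant, arithmetic operation, comparison, connective and
   assignment costs one unit, whatever the size of its operands. *)
Fixpoint ecost (e : expr) : nat :=
  match e with
  | Var _ | Cst _ => 1
  | Add e1 e2 | Sub e1 e2 | Mul e1 e2 | Div e1 e2 => (ecost e1 + ecost e2).+1
  end.

Fixpoint tcost (b : test) : nat :=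
  match b with
  | Eq e1 e2 | Le e1 e2 | Lt e1 e2 => (ecost e1 + ecost e2).+1
  | And b1 b2 => (tcost b1 + tcost b2).+1
  end.

(* [exec c s s' t]: started in [s], [c] terminates in [s'] after [t] units. *)
Inductive exec : com -> state -> state -> nat -> Prop :=
| ExSkip s : exec Skip s s 1
| ExAssign s x e : exec (Assign x e) s (upd s x (eval s e)) (ecost e).+1
| ExSeq c1 c2 s s1 s2 t1 t2 :
    exec c1 s s1 t1 -> exec c2 s1 s2 t2 -> exec (Seq c1 c2) s s2 (t1 + t2)
| ExIf b c1 c2 s s' t :
    exec (if holds s b then c1 else c2) s s' t ->
    exec (If b c1 c2) s s' (tcost b + t)
| ExWhileF b c s :
    holds s b = false -> exec (While b c) s s (tcost b)
| ExWhileT b c s s1 s2 t1 t2 :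
    holds s b -> exec c s s1 t1 -> exec (While b c) s1 s2 t2 ->
    exec (While b c) s s2 (tcost b + t1 + t2).

Lemma exec_det c s s1 s2 t1 t2 :
  exec c s s1 t1 -> exec c s s2 t2 -> s1 = s2 /\ t1 = t2.
Proof.
move=> E; elim: E s2 t2 => {c s s1 t1}.
- by move=> s s2 t2 E; inversion E.
- by move=> s x e s2 t2 E; inversion E.
- move=> c1 c2 s s1 s2 t1 t2 _ IH1 _ IH2 s' t' E.
  inversion E as [| |? ? ? ? ? ? ? E1 E2| | |]; subst.
  have [? ?] := IH1 _ _ E1; subst.
  by have [? ?] := IH2 _ _ E2; subst.
- move=> b c1 c2 s s' t _ IH s2 t2 E.
  inversion E as [| | |? ? ? ? ? ? E1| |]; subst.
  by have [? ?] := IH _ _ E1; subst.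
- move=> b c s hb s2 t2 E; inversion E; subst => //; congruence.
- move=> b c s s1 s2 t1 t2 hb _ IH1 _ IH2 s' t' E.
  inversion E as [| | | |? ? ? hb'|? ? ? ? ? ? ? _ E1 E2]; subst.
    congruence.
  have [? ?] := IH1 _ _ E1; subst.
  by have [? ?] := IH2 _ _ E2; subst.
Qed.

Declare Scope imp_scope.
Delimit Scope imp_scope with imp.
Bind Scope imp_scope with expr test com.
Coercion Var : var >-> expr.
Coercion Cst : nat >-> expr.
Notation "x + y" := (Add x y) : imp_scope.
Notation "x - y" := (Sub x y) : imp_scope.
Notation "x * y" := (Mul x y) : imp_scope.
Notation "x / y" := (Div x y) : imp_scope.
Notation "x == y" := (Eq x y) : imp_scope.
Notation "x <= y" := (Le x y) : imp_scope.
Notation "x < y" := (Lt x y) : imp_scope.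
Notation "x && y" := (And x y) : imp_scope.
Notation "x ::= e" := (Assign x e%imp) (at level 75) : imp_scope.
Notation "c1 ;; c2" := (Seq c1 c2) (at level 80, right associativity) : imp_scope.

(* In the i-th round va = a_i and vp = 3^i; the summation stops at the first i
   with a_i - 1 > vm. *)
Definition compute_R : com := (
  va ::= 3 ;;
  vp ::= 3 ;;
  vr ::= 0 ;;
  While (va - 1 <= vm) (
    vr ::= vr + (vm - (va + 1)) / vp ;;
    va ::= 3 * va - 1 ;;
    vp ::= 3 * vp))%imp.

(* One search step: test whether n = m + R(m). *)
Definition probe : com := (
  vsteps ::= vsteps + 1 ;;
  compute_R ;;
  If (vm + vr == vn) (vfound ::= 1) Skip)%imp.

(* Both bounds are inclusive. The midpoint is rounded up, so that [vlo ::= vm]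
   makes progress; the last candidate vlo = vhi is probed after the loop. The
   answer is left in vm. *)
Definition search : com := (
  vlo ::= 1 ;;
  vhi ::= vn ;;
  vfound ::= 0 ;;
  vsteps ::= 0 ;;
  While ((vfound == 0) && (vlo < vhi)) (
    vm ::= (vlo + vhi + 1) / 2 ;;
    probe ;;
    If (vfound == 0)
      (If (vm + vr < vn) (vlo ::= vm) (vhi ::= vm - 1))
      Skip) ;;
  If (vfound == 0) (vm ::= vlo ;; probe) Skip)%imp.

(* Main.v *)
Require Import Defs.
From mathcomp Require Import all_boot.
From mathcomp Require Import zify.

(** Write f(m) = m + R(m). The theorem rests on the fact that the integers n
    with B(n) = m are exactly those with f(m) <= n < f(m+1)
    ([B_eq_block]), and that such a block has length 1 or 2
    ([first_index_step]). Hence n is either f(m) or f(m) + 1, and B(n) is the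
    last m with f(m) <= n, which a binary search for a solution of n = f(m)
    locates.

    Both facts come from a self-similarity of R. Since a_{i+1} + 1 = 3 a_i, the
    term of index i+1 at m equals the term of index i at floor(m/3) + 1, so
    R(m) = floor((m-4)/3) + R(floor(m/3) + 1) for m >= 4 ([R_rec]). For u >= 2
    this gives
      f(3u) = 3u + f(u+1) - 3,  f(3u+1) = f(3u) + 2,  f(3u+2) = f(3u) + 3,
    so the blocks of 3u, 3u+1, 3u+2 have lengths 2, 1 and the length of the
    block of u+1. This bounds block lengths by induction. It also makes the
    recurrence for B checkable: in the block of 3u+e the three arguments
    n - B(n-k) lie within distance 2 of f(u+1), hence in the blocks of
    u-1, u, u+1, and the three indices add up to 3u+e in every case.

    For the running time, 2^i <= a_i - 1 bounds the number of rounds in one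
    evaluation of R(m) by log m, and every search step halves the length of the
    interval. *)

(** * The sequence a and the self-similarity of R *)

Lemma a_succ i : 0 < i -> a i.+1 = 3 * a i - 1.
Proof. by case: i. Qed.

Lemma a_ge3 i : 2 < a i.
Proof.
elim: i => // -[//|i] IH.
by rewrite a_succ //; lia.
Qed.

Lemma leq_a i j : i <= j -> a i <= a j.
Proof.
elim: j => [|j IH]; first by rewrite leqn0 => /eqP ->.
rewrite leq_eqVlt => /orP[/eqP -> //|/IH aij].
apply: leq_trans aij _; case: j {IH} => // j.
by have := a_ge3 j.+1; rewrite (@a_succ j.+1) //; lia.
Qed.

Lemma exp2_lt_a i : 0 < i -> 2 ^ i < a i.
Proof.
elim: i => // -[//|i] IH _.
by have := IH isT; rewrite (@a_succ i.+1) // (expnS 2 i.+1); lia.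
Qed.

Lemma R_small m : m < 4 -> R m = 0.
Proof.
move=> m4; rewrite /R big1 // => i _; rewrite /Rterm.
have a3 := a_ge3 i.
by rewrite (_ : m - (a i + 1) = 0) ?div0n //; lia.
Qed.

Lemma Rterm_succ m i : 0 < i -> Rterm m i.+1 = Rterm (m %/ 3 + 1) i.
Proof.
move=> i0; rewrite /Rterm expnS divnMA; congr (_ %/ _).
by have := a_ge3 i; rewrite a_succ //; lia.
Qed.

(** For m = 3 the truncated subtraction m - 4 is harmless, as both sides are 0. *)
Lemma R_rec m : 2 < m -> R m = (m - 4) %/ 3 + R (m %/ 3 + 1).
Proof.
move=> m3; rewrite {1}/R big_ltn; last lia.
congr (_ + _).
rewrite -(@R_stable _ m.-1); last lia.
rewrite big_add1 prednK; last lia.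
by apply: eq_big_nat => i /andP[i0 _]; apply: Rterm_succ.
Qed.

(** The partial sum of R m below i is complete once a_i exceeds m + 1. *)
Lemma R_partial m i : 0 < i -> m < a i - 1 ->
  \sum_(1 <= j < i) Rterm m j = R m.
Proof.
move=> i0 mi.
rewrite -(@R_stable m (m + i)); last lia.
rewrite [RHS](@big_cat_nat _ _ _ i) //=; last lia.
rewrite [X in _ = _ + X]big1_seq ?addn0 // => j /=.
rewrite mem_index_iota => /andP[ij _]; rewrite /Rterm.
have aij := @leq_a _ _ ij.
by rewrite (_ : m - _ = 0) ?div0n //; lia.
Qed.

(** * Blocks of equal values of B *)

(** The least n with B n = m, for m > 0. *)
Definition first_index (m : nat) : nat := m + R m.

Lemma first_index_small m : m < 7 -> first_index m = m.
Proof.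
move=> m7; rewrite /first_index.
case: (ltnP m 4) => m4; first by rewrite R_small ?addn0.
by rewrite R_rec 1?R_small; lia.
Qed.

Lemma first_index_mul3 u : 1 < u ->
  first_index (3 * u) + 3 = 3 * u + first_index (u + 1).
Proof.
move=> u1; rewrite /first_index R_rec; last lia.
by rewrite (_ : 3 * u %/ 3 + 1 = u + 1); lia.
Qed.

Lemma first_index_mul3D1 u : 0 < u ->
  first_index (3 * u + 1) + 1 = 3 * u + first_index (u + 1).
Proof.
move=> u1; rewrite /first_index R_rec; last lia.
by rewrite (_ : (3 * u + 1) %/ 3 + 1 = u + 1); lia.
Qed.

Lemma first_index_mul3D2 u : 0 < u ->
  first_index (3 * u + 2) = 3 * u + first_index (u + 1).
Proof.
move=> u1; rewrite /first_index R_rec; last lia.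
by rewrite (_ : (3 * u + 2) %/ 3 + 1 = u + 1); lia.
Qed.

Lemma first_index_step m :
  first_index m < first_index m.+1 <= first_index m + 2.
Proof.
elim/ltn_ind: m => m IH.
case: (ltnP m 6) => m6; first by rewrite !first_index_small; lia.
have [u mu] : exists u, m = 3 * u \/ m = 3 * u + 1 \/ m = 3 * u + 2.
  by exists (m %/ 3); lia.
have u1 : 1 < u by lia.
have f0 := @first_index_mul3 u u1.
have f1 := @first_index_mul3D1 u (ltnW u1).
have f2 := @first_index_mul3D2 u (ltnW u1).
have f3 := @first_index_mul3 u.+1 (ltnW u1).
case: mu => [mu|[mu|mu]]; subst m.
- by rewrite -(addn1 (3 * u)); lia.
- by rewrite -addnS; lia.
have /andP[] := IH (u + 1) ltac:(lia).
rewrite (_ : (3 * u + 2).+1 = 3 * u.+1); last lia.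
by move: f2 f3; rewrite (_ : u.+1 + 1 = (u + 1).+1); lia.
Qed.

Lemma leq_first_index : {mono first_index : m k / m <= k}.
Proof.
apply: leq_mono; apply: homo_ltn; first exact: ltn_trans.
by move=> m; have /andP[] := first_index_step m.
Qed.

(** The recurrence is verified at one n > 5 against the values of B at smaller
    indices; with u = v + 2 and w = 3v, the values B (n - k) are found among
    w + 3, ..., w + 8, and the arguments n - B (n - k) in the blocks of
    v + 1, v + 2, v + 3. *)
Lemma B_eq_block B : isB B -> forall n m, 0 < m ->
  first_index m <= n < first_index m.+1 -> B n = m.
Proof.
move=> [[B1 B2 B3 B4 B5] Brec]; elim/ltn_ind => n IH m m0 nm.
have mn : m <= n by move: nm; rewrite {1}/first_index; lia.
case: (ltnP n 6) => n6.
  have nE : n = m by move: nm; rewrite !first_index_small; lia.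
  rewrite -nE in m0 *; move: m0 n6; clear -B1 B2 B3 B4 B5.
  by do 6?[case: n => [|n] //].
have m6 : 5 < m.
  case: (ltnP 5 m) => // m5.
  by move: nm; rewrite (@first_index_small m.+1) //; lia.
pose inblock k j := [&& 0 < j, 0 < k < n & first_index j <= k < first_index j.+1].
have Brec_blocks p1 p2 p3 q1 q2 q3 :
    [&& inblock (n - 1) p1, inblock (n - 2) p2 & inblock (n - 3) p3] ->
    [&& inblock (n - p1) q1, inblock (n - p2) q2 & inblock (n - p3) q3] ->
    q1 + q2 + q3 = m -> B n = m.
  have Bblock k j : inblock k j -> B k = j.
    by case/and3P=> j0 /andP[_ kn] kj; apply: IH.
  move=> /and3P[/Bblock h1 /Bblock h2 /Bblock h3].
  move=> /and3P[/Bblock k1 /Bblock k2 /Bblock k3] <-.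
  by rewrite Brec // h1 h2 h3 k1 k2 k3.
have [v [w [wE mE]]] : exists v w, w = 3 * v /\
    (m = w.+4.+2 \/ m = w.+4.+3 \/ m = w.+4.+4).
  by exists (m %/ 3 - 2), (3 * (m %/ 3 - 2)); lia.
have f4 : first_index w.+4 + 1 = w + 3 + first_index v.+2.
  have := @first_index_mul3D1 v.+1 isT.
  by rewrite (addn1 v.+1) (_ : 3 * v.+1 + 1 = w.+4); lia.
have f5 : first_index w.+4.+1 = w + 3 + first_index v.+2.
  have := @first_index_mul3D2 v.+1 isT.
  by rewrite (addn1 v.+1) (_ : 3 * v.+1 + 2 = w.+4.+1); lia.
have f6 : first_index w.+4.+2 + 3 = w + 6 + first_index v.+3.
  have := @first_index_mul3 v.+2 isT.
  by rewrite (addn1 v.+2) (_ : 3 * _ = w.+4.+2); lia.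
have f7 : first_index w.+4.+3 + 1 = w + 6 + first_index v.+3.
  have := @first_index_mul3D1 v.+2 isT.
  by rewrite (addn1 v.+2) (_ : 3 * v.+2 + 1 = w.+4.+3); lia.
have f8 : first_index w.+4.+4 = w + 6 + first_index v.+3.
  have := @first_index_mul3D2 v.+2 isT.
  by rewrite (addn1 v.+2) (_ : 3 * v.+2 + 2 = w.+4.+4); lia.
have f9 : first_index w.+4.+4.+1 + 3 = w + 9 + first_index v.+4.
  have := @first_index_mul3 v.+3 isT.
  by rewrite (addn1 v.+3) (_ : 3 * _ = w.+4.+4.+1); lia.
have s3 := first_index_step w.+3.
have s1 := first_index_step v.+1.
have s2 := first_index_step v.+2.
have s4 := first_index_step v.+3.
have v1 : v.+1 <= first_index v.+1 by apply: leq_addr.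
case: mE => [mE|[mE|mE]]; subst m.
(* The block of w + 5 has the same length, 1 or 2, as that of v + 2. *)
- case: (ltnP (first_index v.+2).+1 (first_index v.+3)) => r2.
  + case: (eqVneq n (first_index w.+4.+2)) => nE.
    * by apply: (Brec_blocks w.+4.+1 w.+4.+1 w.+4 v.+2 v.+2 v.+2);
      rewrite /inblock; lia.
    * by apply: (Brec_blocks w.+4.+2 w.+4.+1 w.+4.+1 v.+2 v.+2 v.+2);
      rewrite /inblock; lia.
  + case: (eqVneq n (first_index w.+4.+2)) => nE.
    * by apply: (Brec_blocks w.+4.+1 w.+4 w.+3 v.+1 v.+2 v.+3);
      rewrite /inblock; lia.
    * by apply: (Brec_blocks w.+4.+2 w.+4.+1 w.+4 v.+1 v.+2 v.+3);
      rewrite /inblock; lia.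
- by apply: (Brec_blocks w.+4.+2 w.+4.+2 w.+4.+1 v.+2 v.+2 v.+3);
      rewrite /inblock; lia.
- case: (eqVneq n (first_index w.+4.+4)) => nE.
  + by apply: (Brec_blocks w.+4.+3 w.+4.+2 w.+4.+2 v.+2 v.+3 v.+3);
      rewrite /inblock; lia.
  + by apply: (Brec_blocks w.+4.+4 w.+4.+3 w.+4.+2 v.+2 v.+3 v.+3);
      rewrite /inblock; lia.
Qed.

(** * Total correctness with running time *)

(** Started in [s], the command [c] terminates in a state [s'] after [t] units
    with [Q s' t]. *)
Definition runs (c : com) (s : state) (Q : state -> nat -> Prop) : Prop :=
  exists s' t, exec c s s' t /\ Q s' t.

Lemma runs_weaken c s (P Q : state -> nat -> Prop) :
  runs c s P -> (forall s' t, P s' t -> Q s' t) -> runs c s Q.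
Proof. by move=> [s' [t [E p]]] PQ; exists s', t; split=> //; apply: PQ. Qed.

Lemma runs_skip s Q : Q s 1 -> runs Skip s Q.
Proof. by exists s, 1; split=> //; constructor. Qed.

Lemma runs_assign x e s Q :
  Q (upd s x (eval s e)) (ecost e).+1 -> runs (Assign x e) s Q.
Proof. by exists (upd s x (eval s e)), (ecost e).+1; split=> //; constructor. Qed.

Lemma runs_seq c1 c2 s Q :
  runs c1 s (fun s1 t1 => runs c2 s1 (fun s2 t2 => Q s2 (t1 + t2))) ->
  runs (Seq c1 c2) s Q.
Proof.
move=> [s1 [t1 [E1 [s2 [t2 [E2 q]]]]]].
by exists s2, (t1 + t2); split=> //; apply: ExSeq E1 E2.
Qed.

Lemma runs_if b c1 c2 s Q :
  runs (if holds s b then c1 else c2) s (fun s' t => Q s' (tcost b + t)) ->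
  runs (If b c1 c2) s Q.
Proof.
by move=> [s' [t [E q]]]; exists s', (tcost b + t); split=> //; apply: ExIf.
Qed.

Lemma runs_while b c s (Q : state -> nat -> Prop) :
  (if holds s b then
     runs c s (fun s1 t1 =>
       runs (While b c) s1 (fun s2 t2 => Q s2 (tcost b + t1 + t2)))
   else Q s (tcost b)) ->
  runs (While b c) s Q.
Proof.
case hb: (holds s b); last first.
  by move=> q; exists s, (tcost b); split=> //; apply: ExWhileF.
move=> [s1 [t1 [E1 [s2 [t2 [E2 q]]]]]].
by exists s2, (tcost b + t1 + t2); split=> //; apply: ExWhileT E1 E2.
Qed.

(** * Evaluation of R *)

(** The registers that the evaluation of R overwrites. *)
Definition scratch (x : var) : bool :=
  match x with va | vp | vr => true | _ => false end.

(** One round of the summation of R(m). *)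
Definition sum_body : com := (
  vr ::= vr + (vm - (va + 1)) / vp ;;
  va ::= 3 * va - 1 ;;
  vp ::= 3 * vp)%imp.

(** At most [k] further rounds are run when a_{i+k} exceeds m + 1; a round
    costs 25 units. *)
Lemma runs_sum_loop k i s : 0 < i ->
  s va = a i -> s vp = 3 ^ i -> s vr = \sum_(1 <= j < i) Rterm (s vm) j ->
  s vm < a (i + k) - 1 ->
  runs (While (va - 1 <= vm)%imp sum_body) s (fun s' t =>
    [/\ s' vr = R (s vm), forall x, ~~ scratch x -> s' x = s x
      & t <= 25 * k + 5]).
Proof.
elim: k i s => [|k IH] i s i0 sa sp sr mk; apply: runs_while => /=; rewrite sa.
  rewrite addn0 in mk; rewrite leqNgt mk /=.
  by split=> //; rewrite sr R_partial.
case: (leqP (a i - 1)) => mi /=; last by split=> //; [rewrite sr R_partial | lia].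
apply: runs_seq; apply: runs_assign; apply: runs_seq; apply: runs_assign.
apply: runs_assign.
set s1 := upd _ _ _; apply: runs_weaken (IH i.+1 s1 _ _ _ _ _) _ => //.
- by rewrite a_succ // -sa.
- by rewrite expnS -sp.
- by rewrite big_nat_recr //= /s1 /upd /= sr sa sp.
- by rewrite addSnnS.
move=> s' t [-> ss' tk]; split=> //; last by move: tk; rewrite /=; lia.
by move=> x sx; rewrite ss' //; case: x sx.
Qed.

Lemma runs_compute_R L s : s vm < 2 ^ L.+1 ->
  runs compute_R s (fun s' t =>
    [/\ s' vr = R (s vm), forall x, ~~ scratch x -> s' x = s x
      & t <= 25 * L + 11]).
Proof.
move=> mL.
do 3!(apply: runs_seq; apply: runs_assign).
set s1 := upd _ _ _; apply: runs_weaken (@runs_sum_loop L 1 s1 _ _ _ _ _) _ => //.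
- by rewrite big_geq.
- have aL := @exp2_lt_a L.+1 isT.
  by rewrite add1n ltn_subRL add1n; apply: leq_ltn_trans aL.
move=> s' t [-> ss' tL]; split=> //; last by move: tL; rewrite /=; lia.
by move=> x sx; rewrite ss' //; case: x sx.
Qed.

(** * The binary search *)

Lemma runs_probe L s : s vm < 2 ^ L.+1 ->
  runs probe s (fun s' t =>
    [/\ [/\ s' vn = s vn, s' vlo = s vlo, s' vhi = s vhi & s' vm = s vm],
        s' vr = R (s vm), s' vsteps = s vsteps + 1,
        s' vfound = (if first_index (s vm) == s vn then 1 else s vfound)
      & t <= 25 * L + 22]).
Proof.
move=> mL; apply: runs_seq; apply: runs_assign; apply: runs_seq.
set s1 := upd _ _ _; apply: runs_weaken (@runs_compute_R L s1 mL) _.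
move=> s2 t2 [r2 ss2 tL]; apply: runs_if => /=.
rewrite r2 !ss2 //= -[s1 vm]/(s vm) -[s1 vn]/(s vn) -/(first_index _).
case: eqP => _; [apply: runs_assign | apply: runs_skip];
  by split; rewrite /upd /= ?r2 ?ss2 //; lia.
Qed.

(** The body of the search loop: halve the interval at its midpoint, unless the
    midpoint solves n = m + R(m). *)
Definition search_step : com := (
  vm ::= (vlo + vhi + 1) / 2 ;;
  probe ;;
  If (vfound == 0)
    (If (vm + vr < vn) (vlo ::= vm) (vhi ::= vm - 1))
    Skip)%imp.

(** The outcome of the loop: either n = f(m), or the interval has shrunk to the
    single candidate whose block contains n. *)
Definition search_outcome (n : nat) (s : state) : Prop :=
  (s vfound = 1 /\ (0 < s vm) && (first_index (s vm) == n)) \/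
  (s vfound = 0 /\
    (0 < s vlo) && (first_index (s vlo) <= n < first_index (s vlo).+1)).

(** The invariant is f(lo) <= n < f(hi + 1); an interval with hi - lo < 2^k
    takes at most k steps. *)
Lemma runs_search_loop L k n s : s vn = n -> s vfound = 0 -> n < 2 ^ L.+1 ->
  0 < s vlo <= s vhi -> s vhi <= n -> s vhi - s vlo < 2 ^ k ->
  first_index (s vlo) <= n < first_index (s vhi).+1 ->
  runs (While ((vfound == 0) && (vlo < vhi))%imp search_step) s (fun s' t =>
    [/\ s' vn = n, search_outcome n s', s' vsteps <= s vsteps + k
      & t <= k * (25 * L + 49) + 7]).
Proof.
move=> sn s0 nL; elim: k s sn s0 => [|k IH] s sn s0 lohi hin dk blk;
  apply: runs_while => /=; rewrite s0 eqxx /=.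
  have lh : s vlo = s vhi by move: dk; rewrite expn0; lia.
  rewrite ltnNge lh leqnn /=; split=> //; last lia.
  by right; rewrite lh in lohi blk *; split=> //; lia.
case: (ltnP (s vlo)) => lh; last first.
  have {}lh : s vlo = s vhi by lia.
  split=> //; [|lia|lia].
  by right; rewrite lh in lohi blk *; split=> //; lia.
apply: runs_seq; apply: runs_assign; apply: runs_seq.
set s1 := upd _ _ _; set m := s1 vm.
have mE : m = (s vlo + s vhi + 1) %/ 2 by [].
have mL : s1 vm < 2 ^ L.+1 by rewrite -/m; lia.
apply: runs_weaken (runs_probe _ _ mL) _; rewrite -/m.
rewrite -[s1 vn]/(s vn) -[s1 vlo]/(s vlo) -[s1 vhi]/(s vhi).
rewrite -[s1 vfound]/(s vfound) -[s1 vsteps]/(s vsteps) sn s0.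
move=> s2 t2 [[n2 lo2 hi2 m2] r2 steps2 found2 t2L].
apply: runs_if => /=; rewrite found2; case: eqP found2 => fm found2 /=.
  apply: runs_skip; apply: runs_while; rewrite /= found2 /=.
  split=> //; [|lia|lia].
  by left; rewrite m2 fm; split=> //; lia.
have dkE : s vhi - s vlo < 2 * 2 ^ k by rewrite -expnS.
apply: runs_if => /=; rewrite m2 r2 n2 -/(first_index m); case: ltnP => fmn.
  apply: runs_assign; set s3 := upd _ _ _.
  apply: runs_weaken (IH s3 _ _ _ _ _ _) _;
    rewrite /s3 /upd /= ?m2 ?hi2 //; try lia.
  by move=> s' t [? ? ? ?]; split=> //; lia.
apply: runs_assign; set s3 := upd _ _ _.
apply: runs_weaken (IH s3 _ _ _ _ _ _) _;
  rewrite /s3 /upd /= ?m2 ?lo2 //; try lia.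
  by rewrite (_ : (m - 1).+1 = m); lia.
by move=> s' t [? ? ? ?]; split=> //; lia.
Qed.

Lemma runs_search n s : 0 < n -> s vn = n ->
  runs search s (fun s' t =>
    [/\ s' vm = s' vlo \/ s' vfound = 1,
        s' vfound = (first_index (s' vm) == n),
        (0 < s' vm) && (first_index (s' vm) <= n < first_index (s' vm).+1),
        s' vsteps <= trunc_log 2 n + 2
      & t <= (trunc_log 2 n + 2) * (25 * trunc_log 2 n + 49)]).
Proof.
move=> n0 sn; set L := trunc_log 2 n.
have nL : n < 2 ^ L.+1 by apply: trunc_log_ltn.
do 4!(apply: runs_seq; apply: runs_assign); apply: runs_seq.
set s1 := upd _ _ _.
apply: runs_weaken (@runs_search_loop L L.+1 n s1 _ _ _ _ _ _ _) _ => //.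
- by rewrite /s1 /upd /= sn n0.
- by rewrite /s1 /upd /= sn.
- by rewrite /s1 /upd /= sn; lia.
- rewrite /s1 /upd /= sn first_index_small // n0 /=.
  by rewrite leq_addr.
move=> s2 t2 [n2 out2 steps2 t2L].
rewrite -[s1 vsteps]/0 add0n in steps2.
apply: runs_if => /=; case: out2 => -[found2 /andP[gt0 blk]].
  rewrite found2 /=; apply: runs_skip; split=> //;
    [by right | by rewrite blk | | lia | lia].
  rewrite gt0 (eqP blk) leqnn /= -{1}(eqP blk).
  by have /andP[] := first_index_step (s2 vm).
rewrite found2 /=; apply: runs_seq; apply: runs_assign.
set s3 := upd _ _ _.
have mL : s3 vm < 2 ^ L.+1.
  apply: leq_ltn_trans nL.
  by case/andP: blk => /(leq_trans _) -> //; apply: leq_addr.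
apply: runs_weaken (runs_probe _ _ mL) _.
move=> s' t [[n' lo' hi' m'] r' steps' found' tL'].
move: n' lo' hi' m' steps' found'.
rewrite -[s3 vn]/(s2 vn) -[s3 vlo]/(s2 vlo) -[s3 vhi]/(s2 vhi) -[s3 vm]/(s2 vlo).
rewrite -[s3 vfound]/(s2 vfound) -[s3 vsteps]/(s2 vsteps) n2 found2.
move=> n' lo' hi' m' steps' found'.
split; rewrite ?m' ?lo' ?gt0 //=; [by left | lia | lia].
Qed.

(* Registers other than [vn] hold arbitrary values initially.  [C] depends
   neither on [n] nor on them; log n is [trunc_log 2 n], which is positive and
   within constant factors of the real logarithm for n >= 2. *)
Theorem mainTheorem3 (B : nat -> nat) (hB : isB B) :
  exists C : nat, forall (n : nat) (s : state), 0 < n -> s vn = n ->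
    exists (s' : state) (t : nat),
      [/\ exec search s s' t,
          (s' vfound = 1 /\ n = s' vm + R (s' vm))
          \/ [/\ s' vfound = 0,
                 forall m, 0 < m -> n <> m + R m,
                 s' vm = s' vlo
               & n = s' vlo + R (s' vlo) + 1],
          B n = s' vm /\ B n <= n
        & 1 < n ->
          s' vsteps <= C * trunc_log 2 n /\ t <= C * trunc_log 2 n ^ 2].
Proof.
(* 222 = 3 * 74, as (L + 2) * (25 L + 49) <= 3 L * 74 L for L >= 1. *)
exists 222 => n s n0 sn.
have [s' [t [E [lom found /andP[m0 blk] steps tL]]]] := runs_search _ _ n0 sn.
have Bn := B_eq_block _ hB _ _ m0 blk.
exists s', t; split=> //.
- rewrite -/(first_index (s' vm)); case: eqP found => [-> | fm] found.
    by left.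
  right; case: lom => [lom|]; last by rewrite found.
  have step := first_index_step (s' vm).
  split=> //; last by rewrite -lom -/(first_index _); lia.
  move=> m _ nm; move: fm blk; rewrite nm -/(first_index m).
  rewrite (leqW_mono leq_first_index) leq_first_index => fm.
  by rewrite ltnS -eqn_leq => /eqP mE; rewrite mE in fm.
- rewrite Bn; split=> //.
  by case/andP: blk => /(leq_trans _) -> //; apply: leq_addr.
move=> n1; have L0 : 0 < trunc_log 2 n by rewrite trunc_log_gt0.
move: steps tL; set L := trunc_log 2 n in L0 *; split; first lia.
apply: leq_trans tL _; rewrite expnS expn1; nia.
Qed.
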